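(* Let $(S,\Sigma_S,\nu)$ and $(T,\Sigma_T,\eta)$ be standard measure spaces, let $b\colon T\to[0,\nu(S)]$ and $c\colon S\to[0,\eta(T)]$ be Borel measurable, and let $E\subseteq S\times T$ be measurable with respect to $\Sigma_S\otimes\Sigma_T$. With $\mu=\nu\otimes\eta$, let $m_E(b,c)$ be the supremum of $\mu(F)$ over all measurable sets $F\subseteq E$ such that $\nu(F_t)\le b(t)$ for $\eta$-almost every $t\in T$ and $\eta(F^s)\le c(s)$ for $\nu$-almost every $s\in S$. Then $$m_E(b,c)=\min_{A\in\Sigma_T}\Big\{\int_{T\setminus A}b(t)\,d\eta(t)+\int_S\min\{c(s),d_E(A,s)\}\,d\nu(s)\Big\},$$ where $d_E(A,s)=\eta(E^s\cap A)$; in particular the minimum is attained.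
   Context: A standard measure space is a standard Borel space equipped with a finite atomless measure. For $X\subseteq S\times T$, the sections are $X_t=\{s\in S\mid(s,t)\in X\}$ for $t\in T$ and $X^s=\{t\in T\mid(s,t)\in X\}$ for $s\in S$. $\nu\otimes\eta$ is the product measure on $\Sigma_S\otimes\Sigma_T$. *)

(* Defs.v *)
From mathcomp Require Export all_boot all_order all_algebra.
From mathcomp Require Export all_classical all_reals all_analysis.

Set Implicit Arguments.
Unset Strict Implicit.
Unset Printing Implicit Defensive.

Import Order.TTheory GRing.Theory Num.Theory.
Import numFieldNormedType.Exports.

Local Open Scope classical_set_scope.
Local Open Scope ring_scope.
Local Open Scope ereal_scope.

Definition complete_metric (R : realType) (M : metricType R) : Prop :=
  forall F : set_system M, ProperFilter F -> cauchy F -> exists x : M, F --> x.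

Definition separable (X : topologicalType) : Prop :=
  exists2 D : set X, countable D & dense D.

(* Isomorphism with a Polish space M carrying its Borel sigma-algebra.  As a
   [measurableType] is pointed, only nonempty spaces are covered. *)
Definition standard_borel (R : realType) (d : measure_display)
    (T : measurableType d) : Prop :=
  exists (M : metricType R) (f : T -> M),
    [/\ complete_metric M, separable M, bijective f &
        forall A : set T, measurable A <-> <<s @open M >> (f @` A)].

Definition is_atom (R : realType) (d : measure_display) (T : measurableType d)
    (mu : set T -> \bar R) (A : set T) : Prop :=
  [/\ measurable A, 0 < mu A &
      forall B : set T, measurable B -> B `<=` A -> mu B = 0 \/ mu B = mu A].

Definition atomless (R : realType) (d : measure_display) (T : measurableType d)
    (mu : set T -> \bar R) : Prop :=
  forall A : set T, ~ is_atom mu A.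

(* Finiteness of the measure is carried by the type of [mu]. *)
Definition standard_measure_space (R : realType) (d : measure_display)
    (T : measurableType d) (mu : {finite_measure set T -> \bar R}) : Prop :=
  standard_borel R T /\ atomless mu.

Section bounded_sections.
Variables (R : realType) (d1 d2 : measure_display).
Variables (S : measurableType d1) (T : measurableType d2).
Variables (nu : {finite_measure set S -> \bar R}).
Variables (eta : {finite_measure set T -> \bar R}).
Implicit Types (E F : set (S * T)) (A : set T) (b : T -> R) (c : S -> R).

(* [ysection F t] is F_t and [xsection F s] is F^s. *)
Definition admissible E b c : set (set (S * T)) :=
  [set F | [/\ measurable F, F `<=` E,
      {ae eta, forall t, nu (ysection F t) <= (b t)%:E} &
      {ae nu, forall s, eta (xsection F s) <= (c s)%:E}]].

Definition max_measure E b c : \bar R :=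
  ereal_sup [set (nu \x eta) F | F in admissible E b c].

Definition degree E A (s : S) : \bar R := eta (xsection E s `&` A).

Definition cut_value E b c A : \bar R :=
  \int[eta]_(t in ~` A) (b t)%:E
  + \int[nu]_s Order.min (c s)%:E (degree E A s).

End bounded_sections.

Definition is_minimum (R : realType) (V : set (\bar R)) (x : \bar R) : Prop :=
  V x /\ lbound V x.

(* Main.v *)
From HB Require Import structures.
Require Import Defs.
From mathcomp Require Import lra ring measurable_realfun.

(** This is a max-flow min-cut theorem.  For the inequality [<=], split an
    admissible [F] according to whether [t] lies in [A]: outside [A] the
    sections [F_t] are bounded by [b t], and inside [A] the section
    [F^s `&` A] is bounded both by [c s] and by the degree of [s] into [A];
    integrating with Tonelli gives [admissible_le_cut].

    The minimum over [A] is attained without any compactness.  The function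
    [x |-> min (c s) x] is concave, so the cut value is submodular in [A]; it
    is also Lipschitz for the measure of symmetric differences.  Along a
    minimizing sequence with errors [2^-n], submodularity keeps the unions of
    the tails nearly minimal, because the corresponding intersections cannot
    fall below the infimum; the limsup of the sequence is then a minimizer
    ([submodular_attains_minimum]).

    It remains to find, for every [e > 0], an admissible set whose measure is
    within [e] of the least cut ([near_optimal_admissible]).  Up to a set of
    small measure, [E] is a union of finitely many rectangles; rounding [b] and
    [c] down to a grid and refining the partitions makes the data finite.
    A cut of the finite network is, up to [O(e)], the cut of the original
    problem along a union of classes ([discretized_cut]), hence at least the
    infimum up to [O(e)].

    In the finite network, lower the capacities of the edges one at a time, as
    far as possible without pushing any cut below [m].  Each edge that
    survives lies in a cut of value exactly [m], and uncrossing these cuts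
    shows that the remaining capacities themselves satisfy all the constraints:
    they are a flow of value at least [m] ([finite_max_flow]).

    Finally the fractional flow is realized by a set ([realize_flow]).  This is
    where atomlessness enters: by Sierpinski's theorem each class of the
    partition of [S], and each class of the partition of [T], splits into
    [n.+1] pieces of equal measure.  In the rectangle [(i, j)] take the product
    of the pieces numbered [x] and [y] whenever [(x + y) %% n.+1 < k], where
    [k / n.+1] approximates the density of the flow from below.  As in a Latin
    square, every horizontal or vertical section then contains exactly [k]
    pieces, so the constraints hold on every section and not only on average. *)

Set Implicit Arguments.
Unset Strict Implicit.
Unset Printing Implicit Defensive.

Import Order.TTheory GRing.Theory Num.Theory.
Import numFieldNormedType.Exports.

Local Open Scope classical_set_scope.
Local Open Scope ring_scope.

(** * Flows in finite bipartite networks *)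

(** Submodularity of a concave function of an additive one: with [v] and [w]
    the values on a union and an intersection, [x] and [y] lie between [w] and
    [v] and have the same midpoint. *)
Lemma min_submod (R : realDomainType) (k x y v w : R) :
    x + y = v + w -> w <= x -> w <= y ->
  Num.min k v + Num.min k w <= Num.min k x + Num.min k y.
Proof.
move=> e wx wy.
case: (leP k v) => kv; case: (leP k w) => kw;
  case: (leP k x) => kx; case: (leP k y) => ky; lra.
Qed.

Section finite_flow.
Variables (R : realDomainType) (I J : finType).
Implicit Types (u : I -> J -> R) (A B : {set J}).
Variables (b : J -> R) (c : I -> R).

Definition load u A i := \sum_(j in A) u i j.

Definition finite_cut u A :=
  \sum_(j in ~: A) b j + \sum_i Num.min (c i) (load u A i).

Lemma sum_setUI (f : J -> R) A B :
  \sum_(j in A) f j + \sum_(j in B) f j =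
  \sum_(j in A :|: B) f j + \sum_(j in A :&: B) f j.
Proof.
rewrite (big_setID B) /= [X in _ = X + _](big_setID B) /=.
rewrite finset.setIUl finset.setIid finset.setDUl finset.setDv finset.setU0.
by rewrite (finset.setUidPr (subsetIr _ _)); lra.
Qed.

Lemma load_sub u A B i : (forall i j, 0 <= u i j) -> A \subset B ->
  load u A i <= load u B i.
Proof.
move=> u0 AB; rewrite /load (big_setID A (A := B)) /= (finset.setIidPr AB).
by rewrite lerDl sumr_ge0.
Qed.

Lemma load_mono u v A i : (forall j, v i j <= u i j) ->
  load v A i <= load u A i.
Proof. by move=> vu; apply: ler_sum. Qed.

Lemma sum_setCUI A B :
  \sum_(j in ~: A) b j + \sum_(j in ~: B) b j =
  \sum_(j in ~: (A :|: B)) b j + \sum_(j in ~: (A :&: B)) b j.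
Proof. by rewrite sum_setUI finset.setCU finset.setCI addrC. Qed.

Lemma finite_cutUI u A B : (forall i j, 0 <= u i j) ->
  finite_cut u (A :|: B) + finite_cut u (A :&: B)
    <= finite_cut u A + finite_cut u B.
Proof.
move=> u0; rewrite /finite_cut addrACA [leRHS]addrACA -sum_setCUI lerD2l.
rewrite -!big_split /=; apply: ler_sum => i _; apply: min_submod.
- exact: sum_setUI.
- exact/load_sub/subsetIl.
- exact/load_sub/subsetIr.
Qed.

(** What remains true of an edge whose capacity cannot be lowered without
    pushing some cut below [m]: if it is positive, it is counted in full by a
    cut of value [m], which requires that the row constraint does not already
    truncate the load. *)
Definition saturated (m : R) u i j :=
  u i j = 0 \/ exists A, [/\ j \in A, finite_cut u A = m & load u A i <= c i].

(** The new capacity is the least one for which all cuts containing [j0] stay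
    above [m]; when it is positive, the cut [A0] that determines it becomes
    tight. *)
Lemma lower_edge m u i0 j0 :
    (forall i j, 0 <= u i j) -> (forall A, m <= finite_cut u A) ->
  exists v, [/\ forall i j, 0 <= v i j <= u i j,
                forall A, m <= finite_cut v A & saturated m v i0 j0].
Proof.
move=> u0 mu.
(* For [A] containing [j0], lowering the edge to a value [x] leaves the cut
   [A] above [m] iff [w A <= x]. *)
pose w A := u i0 j0 + (m - finite_cut u A) + Num.min (c i0) (load u A i0)
            - load u A i0.
have [A0 jA0 wA0] := arg_maxP w
  (finset.in_setT j0 : (fun A => j0 \in A) [set: J]%SET).
pose x := Num.max 0 (w A0).
have x_ge0 : 0 <= x by rewrite le_max lexx.
have xu : x <= u i0 j0.
  rewrite ge_max u0 /= /w; have := mu A0.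
  have : Num.min (c i0) (load u A0 i0) <= load u A0 i0.
    by rewrite ge_min lexx orbT.
  lra.
pose v i j := if (i == i0) && (j == j0) then x else u i j.
have vi A i : i != i0 -> load v A i = load u A i.
  by move=> ii0; apply: eq_bigr => j _; rewrite /v (negPf ii0).
have vnj A i : j0 \notin A -> load v A i = load u A i.
  move=> jA; apply: eq_bigr => j jA'; rewrite /v.
  by case: (eqVneq j j0) jA' jA => [->->//|]; rewrite andbF.
have vj A : j0 \in A -> load v A i0 = load u A i0 - u i0 j0 + x.
  move=> jA; rewrite /load (bigD1 j0) //= [in RHS](bigD1 j0) //= /v !eqxx /=.
  rewrite (eq_bigr (fun j => u i0 j)); first by lra.
  by move=> j /andP[_ /negPf ->].
have cutE A : finite_cut v A = finite_cut u A - Num.min (c i0) (load u A i0)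
    + Num.min (c i0) (load v A i0).
  rewrite /finite_cut (bigD1 i0) //= [in RHS](bigD1 i0) //=.
  rewrite (eq_bigr (fun i => Num.min (c i) (load u A i))); first by lra.
  by move=> i ii0; rewrite vi.
have mv A : m <= finite_cut v A.
  have [jA|jA] := boolP (j0 \in A); last first.
    by rewrite cutE vnj // subrK.
  rewrite cutE vj //.
  have : w A <= x by rewrite le_max (wA0 A jA : w A <= w A0) orbT.
  rewrite /w; have := mu A.
  have : Num.min (c i0) (load u A i0) <= c i0 by rewrite ge_min lexx.
  by case: (leP (c i0) (load u A i0 - u i0 j0 + x)); lra.
exists v; split => //.
  move=> i j; rewrite /v; case: ifP => [/andP[/eqP-> /eqP->]|_].
    by rewrite x_ge0.
  by rewrite u0 lexx.
rewrite /saturated {1}/v !eqxx /=.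
have [w0|w0] := leP (w A0) 0; first by left; rewrite /x; apply/max_idPl.
right; exists A0.
have xE : x = w A0 by apply/max_idPr/ltW.
have lc : load v A0 i0 <= c i0.
  rewrite vj // xE /w; have := mu A0.
  have : Num.min (c i0) (load u A0 i0) <= c i0 by rewrite ge_min lexx.
  lra.
split => //; rewrite cutE (min_idPr lc) vj // xE /w; lra.
Qed.

(** Saturation of an edge survives the lowering of other edges: a tight cut can
    only go down, and it may not go below [m]. *)
Lemma saturated_le m u v i j :
    (forall i j, 0 <= v i j <= u i j) -> (forall A, m <= finite_cut v A) ->
  saturated m u i j -> saturated m v i j.
Proof.
move=> vu mv [u0|[A [jA cA lA]]].
  by left; apply/eqP; rewrite eq_le; have := vu i j; rewrite u0 andbC.
have lvu k : load v A k <= load u A k.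
  by apply: load_mono => l; have /andP[] := vu k l.
right; exists A; split => //; last exact: le_trans lA.
apply/eqP; rewrite eq_le mv andbT -cA /finite_cut lerD2l.
apply: ler_sum => k _; rewrite ge_min.
by case: (leP (c k) (load u A k)) => [_|h]; rewrite ?lexx ?(lvu k) ?orbT.
Qed.

Lemma exists_saturated m u :
    (forall i j, 0 <= u i j) -> (forall A, m <= finite_cut u A) ->
  exists v, [/\ forall i j, 0 <= v i j <= u i j,
                forall A, m <= finite_cut v A & forall i j, saturated m v i j].
Proof.
move=> u0 mu.
suff [v [vu mv sv]] : exists v, [/\ forall i j, 0 <= v i j <= u i j,
    forall A, m <= finite_cut v A &
    forall ij, ij \in enum {: I * J} -> saturated m v ij.1 ij.2].
  by exists v; split => // i j; apply: (sv (i, j)); rewrite mem_enum.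
elim: (enum _) => [|[i j] s [v [vu mv sv]]].
  by exists u; split => // i j; rewrite u0 lexx.
have [|//|w [wv mw sw]] := @lower_edge m v i j _.
  by move=> k l; case/andP: (vu k l).
exists w; split => //.
  move=> i' j'; have /andP[_] := vu i' j'; have /andP[-> /=] := wv i' j'.
  exact: le_trans.
move=> ij; rewrite inE => /predU1P[->//|ijs].
exact: saturated_le (sv _ ijs).
Qed.

(** Tight cuts are stable under union and intersection.  For a row [i], the
    largest tight cut that does not truncate row [i] contains all its edges, so
    the whole row fits below [c i].  For a column [j], the smallest tight cut
    [A] containing [j] counts all edges of the column in full, and comparing it
    with the cut [A :\ j] gives the bound [b j]. *)
Lemma saturated_flow m v :
    (forall i, 0 <= c i) -> (forall j, 0 <= b j) ->
    (forall i j, 0 <= v i j) -> (forall A, m <= finite_cut v A) ->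
    (forall i j, saturated m v i j) ->
  [/\ forall i, \sum_j v i j <= c i, forall j, \sum_i v i j <= b j &
      m <= \sum_i \sum_j v i j].
Proof.
move=> c0 b0 v0 mv sv; split.
- move=> i.
  pose P A := (finite_cut v A == m) && (load v A i <= c i).
  have [[A0 PA0]|noA] := pselect (exists A, P A); last first.
    rewrite big1 // => j _; have [//|[A [jA cA lA]]] := sv i j.
    by case: noA; exists A; rewrite /P cA eqxx.
  have [A /andP[/eqP cA lA] maxA] := arg_maxnP (fun A : {set J} => #|A|) PA0.
  suff -> : \sum_j v i j = load v A i by [].
  rewrite /load [RHS]big_mkcond /=; apply: eq_bigr => j _.
  case: ifPn => // jA; have [//|[B [jB cB lB]]] := sv i j.
  have lAB : load v (A :|: B) i <= c i.
    (* Truncation of row [i] on the union would make submodularity strict. *)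
    rewrite leNgt; apply/negP => lt.
    suff : finite_cut v (A :|: B) + finite_cut v (A :&: B)
        < finite_cut v A + finite_cut v B.
      by rewrite cA cB ltNge; have := mv (A :|: B); have := mv (A :&: B); lra.
    rewrite /finite_cut addrACA [ltRHS]addrACA -sum_setCUI ltrD2l.
    rewrite -!big_split /= (bigD1 i) //= [ltRHS](bigD1 i) //=.
    apply: ltr_leD.
      rewrite (min_idPr lA) (min_idPr lB) (min_idPl (ltW lt)).
      have := sum_setUI (v i) A B; rewrite -!/(load v _ i).
      have := load_sub i v0 (subsetIl A B).
      by rewrite minEle; case: ifP; lra.
    apply: ler_sum => k _; apply: min_submod.
    + exact: sum_setUI.
    + exact/load_sub/subsetIl.
    + exact/load_sub/subsetIr.
  have : (#|A :|: B| <= #|A|)%N.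
    apply: maxA; rewrite /P lAB andbT eq_le mv andbT.
    by have := finite_cutUI A B v0; have := mv (A :&: B); rewrite cA cB; lra.
  rewrite leqNgt proper_card // properE finset.subsetUl /=.
  by apply/subsetPn; exists j; rewrite // inE jB orbT.
- move=> j.
  pose P A := (finite_cut v A == m) && (j \in A).
  have [[A0 PA0]|noA] := pselect (exists A, P A); last first.
    rewrite big1 // => i _; have [//|[A [jA cA lA]]] := sv i j.
    by case: noA; exists A; rewrite /P cA eqxx.
  have [A /andP[/eqP cA jA] minA] := arg_minnP (fun A : {set J} => #|A|) PA0.
  have lA i : v i j = 0 \/ load v A i <= c i.
    have [|[B [jB cB lB]]] := sv i j; [by left|right].
    suff AB : A \subset B by apply: le_trans lB; apply: load_sub.
    have : (#|A| <= #|A :&: B|)%N.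
      apply: minA; rewrite /P inE jA jB /= andbT eq_le mv andbT.
      by have := finite_cutUI A B v0; have := mv (A :|: B); rewrite cA cB; lra.
    move=> h; apply/finset.setIidPl/eqP.
    by rewrite eqEcard subsetIl.
  have : finite_cut v A <= finite_cut v (A :\ j) by rewrite cA.
  rewrite /finite_cut.
  have -> : \sum_(k in ~: (A :\ j)) b k = b j + \sum_(k in ~: A) b k.
    rewrite (bigD1 j) ?inE ?eqxx //=; congr (_ + _); apply: eq_bigl => k.
    rewrite !inE negb_and negbK.
    by case: (eqVneq k j) => [->|]; rewrite ?jA ?andbF ?andbT.
  move=> cutle.
  suff loadE i : Num.min (c i) (load v (A :\ j) i)
      <= Num.min (c i) (load v A i) - v i j.
    have : \sum_i Num.min (c i) (load v (A :\ j) i)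
        <= \sum_i Num.min (c i) (load v A i) - \sum_i v i j.
      by rewrite -sumrB; apply: ler_sum.
    by move: cutle; lra.
  have E : load v A i = v i j + load v (A :\ j) i.
    by rewrite /load (big_setD1 j).
  have [v_eq0|lAi] := lA i; first by rewrite E v_eq0 add0r subr0.
  by rewrite (min_idPr lAi) E addrAC subrr add0r ge_min lexx orbT.
- apply: le_trans (mv [set: J]%SET) _; rewrite /finite_cut.
  rewrite finset.setCT big_set0 add0r; apply: ler_sum => i _.
  rewrite ge_min /load; apply/orP; right.
  by under eq_bigl do rewrite inE.
Qed.

Lemma finite_max_flow m u :
    (forall i, 0 <= c i) -> (forall j, 0 <= b j) ->
    (forall i j, 0 <= u i j) -> (forall A, m <= finite_cut u A) ->
  exists v, [/\ forall i j, 0 <= v i j <= u i j, forall i, \sum_j v i j <= c i,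
                forall j, \sum_i v i j <= b j & m <= \sum_i \sum_j v i j].
Proof.
move=> c0 b0 u0 mu; have [v [vu mv sv]] := exists_saturated u0 mu.
have v0 i j : 0 <= v i j by case/andP: (vu i j).
by have [] := saturated_flow c0 b0 v0 mv sv; exists v.
Qed.

End finite_flow.

(** * Atomless finite measures *)

Section mass.
Context (R : realType) (d : measure_display) (T : measurableType d).
Variable mu : {finite_measure set T -> \bar R}.
Implicit Types A B : set T.

Definition mass A : R := fine (mu A).

Lemma massE A : measurable A -> (mass A)%:E = mu A.
Proof. by move=> mA; rewrite fineK // fin_num_measure. Qed.

Lemma mass_ge0 A : 0 <= mass A.
Proof. exact: fine_ge0. Qed.

Lemma mass0 : mass set0 = 0.
Proof. by rewrite /mass measure0. Qed.

Lemma massU A B : measurable A -> measurable B -> [disjoint A & B] ->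
  mass (A `|` B) = mass A + mass B.
Proof.
move=> mA mB /disj_set2P AB; apply: EFin_inj.
by rewrite EFinD !massE ?measureU //; apply: measurableU.
Qed.

Lemma massD A B : measurable A -> measurable B -> B `<=` A ->
  mass (A `\` B) = mass A - mass B.
Proof.
move=> mA mB BA; rewrite -[in mass A](setDUK BA) massU //; first by ring.
  exact: measurableD.
by apply/disj_set2P; rewrite setDIK.
Qed.

Lemma mass_le A B : measurable A -> measurable B -> A `<=` B ->
  mass A <= mass B.
Proof. by move=> mA mB AB; rewrite -subr_ge0 -massD // mass_ge0. Qed.

Lemma massUI A B : measurable A -> measurable B ->
  mass A + mass B = mass (A `|` B) + mass (A `&` B).
Proof.
move=> mA mB; have mI := measurableI _ _ mA mB.
have -> : A `|` B = A `|` (B `\` A).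
  apply/seteqP; split=> x; last by case=> [|[]]; [left|right].
  by have [Ax _|nAx [//|Bx]] := pselect (A x); [left|right].
rewrite massU //; last by apply/disj_set2P; rewrite setDIK.
  have -> : B `\` A = B `\` (A `&` B) by rewrite setDIr setDv setU0.
  by rewrite massD //; ring.
exact: measurableD.
Qed.

Lemma massU_le A B : measurable A -> measurable B ->
  mass (A `|` B) <= mass A + mass B.
Proof. by move=> mA mB; rewrite massUI // lerDl mass_ge0. Qed.

Lemma mass_ndseq_tail (F : (set T)^nat) (e : R) :
    (forall n, measurable (F n)) -> nondecreasing_seq F -> 0 < e ->
  \forall n \near \oo, mass (\bigcup_k F k `\` F n) < e.
Proof.
move=> mF ndF e0.
have mU : measurable (\bigcup_k F k) by exact: bigcupT_measurable.
have Fmu : mu \o F @ \oo --> mu (\bigcup_k F k) by exact: nondecreasing_cvg_mu.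
have /fine_cvgP[_ /cvgrPdist_lt /(_ _ e0) lt_e] :
  (mu \o F) n @[n --> \oo] --> (mass (\bigcup_k F k))%:E by rewrite massE.
apply: filterS lt_e => n; rewrite massD //; last exact: bigcup_sup.
exact/le_lt_trans/ler_norm.
Qed.

Lemma mass_bigcup_tail (F : (set T)^nat) (e : R) :
    (forall n, measurable (F n)) -> 0 < e ->
  exists n, mass (\bigcup_k F k `\` \bigcup_(k < n) F k) < e.
Proof.
move=> mF e0.
have [||//|n _] := @mass_ndseq_tail (fun n => \bigcup_(k < n) F k) e.
- by move=> n; apply: bigcup_measurable.
- move=> m n mn; apply/subsetPset => x [k /= km Fx].
  by exists k => //=; apply: leq_trans mn.
rewrite (_ : \bigcup_k \bigcup_(i < k) F i = \bigcup_k F k).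
  by move=> /(_ n (leqnn n)) h; exists n.
apply/seteqP; split=> [x [? _ [k _ Fx]]|x [k _ Fx]]; first by exists k.
by exists k.+1 => //; exists k => /=.
Qed.

Hypothesis mu_atomless : atomless mu.

(** A set of positive measure is not an atom, so it splits into two parts of
    positive measure, one of which has at most half the measure. *)
Lemma atomless_small_subset A (e : R) : measurable A -> 0 < mass A -> 0 < e ->
  exists B, [/\ measurable B, B `<=` A, 0 < mass B & mass B <= e].
Proof.
move=> mA A0 e0.
have half B : measurable B -> 0 < mass B ->
    exists C, [/\ measurable C, C `<=` B, 0 < mass C & mass C * 2 <= mass B].
  move=> mB B0.
  have [C [mC CB C0 CneB]] : exists C, [/\ measurable C, C `<=` B, mass C <> 0 &
      mass C <> mass B].
    apply: contrapT => noC; apply: (mu_atomless (A := B)); split=> //.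
      by rewrite -massE // lte_fin.
    move=> C mC CB; apply: contrapT => /not_orP[C0 CneB]; apply: noC.
    exists C; split => //; first by move=> h; apply: C0; rewrite -massE // h.
    by move=> h; apply: CneB; rewrite -!massE // h.
  have CleB := mass_le mC mB CB.
  have Cgt0 : 0 < mass C by rewrite lt_neqAle mass_ge0 andbT; apply/eqP/nesym.
  have CltB : mass C < mass B by rewrite lt_neqAle CleB andbT; apply/eqP.
  have [le2|lt2] := leP (mass C * 2) (mass B); first by exists C.
  exists (B `\` C); rewrite massD //; split => //.
  - exact: measurableD.
  - by rewrite subr_gt0.
  - lra.
have halves n : exists B, [/\ measurable B, B `<=` A, 0 < mass B &
    mass B * n.+1%:R <= mass A].
  elim: n => [|n [B [mB BA B0 Bn]]].
    by exists A; rewrite mulr1; split => // x.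
  have [C [mC CB C0 C2]] := half _ mB B0.
  exists C; split => //; first exact: subset_trans BA.
  apply: le_trans Bn; apply: le_trans (ler_wpM2r (ler0n _ n.+1) C2).
  rewrite -mulrA; apply: ler_wpM2l; rewrite ?(ltW C0) // -natrM ler_nat.
  by rewrite mul2n -addnn !addSn addnS ltnS ltnS leq_addr.
pose n := Num.bound (mass A / e).
have [B [mB BA B0 Bn]] := halves n.
exists B; split => //; rewrite leNgt; apply/negP => eB.
have : mass A / e < n%:R.
  by apply: archi_boundP; rewrite divr_ge0 ?mass_ge0 ?(ltW e0).
rewrite ltr_pdivrMr //.
have : e * n.+1%:R <= mass B * n.+1%:R by rewrite ler_wpM2r // ltW.
by rewrite -natr1 mulrDr; lra.
Qed.


(** The step of an exhaustion: a piece of measure at most [r] that is at least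
    half as large as any other such piece. *)
Lemma greedy_piece A (r : R) : measurable A -> 0 <= r ->
  exists C, [/\ measurable C, C `<=` A, mass C <= r &
    forall D, measurable D -> D `<=` A -> mass D <= r -> mass D <= mass C * 2].
Proof.
move=> mA r0.
pose V :=
  [set mass C | C in [set C | [/\ measurable C, C `<=` A & mass C <= r]]].
have supV : has_sup V.
  split; first by exists (mass set0), set0 => //; rewrite /= mass0; split.
  by exists r => _ [C [_ _ Cr] <-].
have ubV D : measurable D -> D `<=` A -> mass D <= r -> mass D <= sup V.
  by move=> mD DA Dr; apply: ub_le_sup; [case: supV | exists D].
have [s0|s0] := leP (sup V) 0.
  exists set0; rewrite mass0 mul0r; split => // D mD DA Dr.
  exact: le_trans (ubV _ mD DA Dr) s0.
have [||_ [C [mC CA Cr] <-] ltC] := @sup_adherent _ V (sup V / 2) => //.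
  lra.
exists C; split => // D mD DA Dr; have := ubV D mD DA Dr; lra.
Qed.

(** Sierpinski's theorem.  Add greedy pieces without exceeding the total [r].
    If the limit [L] had measure below [r], a small subset of the complement
    would fit at every step, so all pieces would have measure bounded below. *)
Lemma atomless_intermediate A (r : R) : measurable A -> 0 <= r <= mass A ->
  exists B, [/\ measurable B, B `<=` A & mass B = r].
Proof.
move=> mA /andP[r0 rA].
pose ok B := [/\ measurable B, B `<=` A & mass B <= r].
have /choice[f fP] : forall B, exists C, ok B ->
    [/\ measurable C, C `<=` A `\` B, mass C <= r - mass B &
      forall D, measurable D -> D `<=` A `\` B -> mass D <= r - mass B ->
        mass D <= mass C * 2].
  move=> B; have [[mB BA Br]|notok] := pselect (ok B); last by exists set0.
  have [|C hC] := @greedy_piece (A `\` B) (r - mass B) (measurableD mA mB).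
    by rewrite subr_ge0.
  by exists C.
pose B n := iter n (fun B => B `|` f B) set0.
have massS n : ok (B n) -> mass (B n.+1) = mass (B n) + mass (f (B n)).
  move=> okB; have [mB _ _] := okB; have [mf fA _ _] := fP _ okB.
  rewrite /B iterS massU //; apply/disj_set2P/disjoints_subset => x Bx /fA[_].
  exact.
have okB n : ok (B n).
  elim: n => [|n okB]; first by rewrite /ok /B /= mass0; split.
  have [mB BA _] := okB; have [mf fA fr _] := fP _ okB.
  split; last by rewrite massS //; lra.
  - exact: measurableU.
  - by rewrite subUset; split => // x /fA[].
have mB n : measurable (B n) by case: (okB n).
have ndB : nondecreasing_seq B.
  by apply/nondecreasing_seqP => n; apply/subsetPset; exact: subsetUl.
pose L := \bigcup_n B n.
have mL : measurable L by exact: bigcupT_measurable.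
have LA : L `<=` A by apply: bigcup_sub => n _; case: (okB n).
have Lr : mass L <= r.
  rewrite leNgt; apply/negP => rL.
  have [|n _ /(_ n (leqnn n)) /=] := mass_ndseq_tail mB ndB (e := mass L - r).
    by rewrite subr_gt0.
  rewrite massD //; last exact: bigcup_sup.
  by rewrite -/L; have [_ _] := okB n; lra.
exists L; split => //; apply/eqP; rewrite eq_le Lr /= leNgt; apply/negP => ltLr.
have [|||D [mD DL D0 Dr]] := @atomless_small_subset (A `\` L) (r - mass L).
- exact: measurableD.
- by rewrite massD //; lra.
- by rewrite subr_gt0.
have grow n : n%:R * (mass D / 2) <= mass (B n).
  elim: n => [|n IH]; first by rewrite mul0r mass_ge0.
  rewrite massS // -natr1 mulrDl mul1r lerD // ler_pdivrMr //.
  have [_ _ _ maxf] := fP _ (okB n); apply: maxf => //.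
    by apply: subset_trans DL _; apply: setDS; exact: bigcup_sup.
  have : mass (B n) <= mass L by apply: mass_le => //; exact: bigcup_sup.
  lra.
have : r / (mass D / 2) < (Num.bound (r / (mass D / 2)))%:R.
  by apply: archi_boundP; rewrite !divr_ge0 // ltW.
rewrite ltr_pdivrMr ?divr_gt0 //; have := grow (Num.bound (r / (mass D / 2))).
have [_ _] := okB (Num.bound (r / (mass D / 2))).
lra.
Qed.

Lemma atomless_equipartition A n : measurable A ->
  exists Q : T -> 'I_n.+1, forall k, measurable (Q @^-1` [set k]) /\
    mass (A `&` Q @^-1` [set k]) = mass A / n.+1%:R.
Proof.
elim: n A => [|n IH] A mA.
  exists (fun=> ord0) => k.
  rewrite (ord1 k) (_ : _ @^-1` _ = setT) ?setIT ?divr1 //.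
  by apply/seteqP.
have [|B [mB BA Bm]] := @atomless_intermediate A (mass A / n.+2%:R) mA.
  by rewrite divr_ge0 ?mass_ge0 //= ler_pdivrMr // ler_peMr ?mass_ge0 // ler1n.
have [Q QP] := IH _ (measurableD mA mB).
pose Q' t :=
  if pselect (B t) is left _ then ord_max else widen_ord (leqnSn _) (Q t).
have Q'max : Q' @^-1` [set ord_max] = B.
  apply/seteqP; split => t; rewrite /Q' /=; case: pselect => // nB.
  by move=> /(congr1 val) /= h; have := ltn_ord (Q t); rewrite h ltnn.
have Q'lt (k : 'I_n.+1) : Q' @^-1` [set widen_ord (leqnSn _) k] =
    Q @^-1` [set k] `\` B.
  apply/seteqP; split => t; rewrite /Q' /=; case: pselect => //.
  - by move=> _ /(congr1 val) /= h; have := ltn_ord k; rewrite -h ltnn.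
  - by move=> nB /(congr1 val) /= h; split => //; apply: val_inj.
  - by move=> ? [].
  - by move=> _ [-> _].
exists Q' => k; have [kn|kn] := ltnP k n.+1; last first.
  have -> : k = ord_max.
    by apply: val_inj => /=; apply/eqP; rewrite eqn_leq kn -ltnS ltn_ord.
  by rewrite Q'max (setIidr BA) Bm.
have -> : k = widen_ord (leqnSn _) (Ordinal kn) by apply: val_inj.
rewrite Q'lt; have [mQ mass_Q] := QP (Ordinal kn).
split; first exact: measurableD.
rewrite -setIDAC mass_Q massD // Bm.
field; apply/andP; split; apply: lt0r_neq0; exact: ltr_wpDr.
Qed.

End mass.

(** * Finite measurable partitions *)

Section finite_product.
Context (R : realType) (d1 d2 : measure_display).
Context (S : measurableType d1) (T : measurableType d2).
Variables (nu : {finite_measure set S -> \bar R}).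
Variables (eta : {finite_measure set T -> \bar R}).

(** The product measure under a name of its own, to which its finiteness can be
    attached. *)
Definition finite_product : set (S * T) -> \bar R := (nu \x eta)%E.

HB.instance Definition _ := Measure.on finite_product.

Let finite_product_fin_num : fin_num_fun finite_product.
Proof.
apply: lty_fin_num_fun; rewrite -setXTT [ltLHS]product_measure1E //.
by rewrite ltey_eq fin_numM // fin_num_measure.
Qed.

HB.instance Definition _ :=
  Measure_isFinite.Build _ _ _ finite_product finite_product_fin_num.

End finite_product.

Section labels.
Context (R : realType) (d : measure_display) (T : measurableType d).

(** A finite measurable partition is given by the map sending a point to the
    index of its class; common refinements are then pairings. *)
Definition label (I : Type) (p : T -> I) : Prop :=
  forall i, measurable (p @^-1` [set i]).

Lemma label_preimage (I : finType) (p : T -> I) (X : set I) :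
  label p -> measurable (p @^-1` X).
Proof.
move=> mp; have -> : p @^-1` X = \bigcup_(i in X) p @^-1` [set i].
  by apply/seteqP; split=> [t Xt|t [i Xi /= ->//]]; exists (p t).
by apply: fin_bigcup_measurable => // *; apply: finite_finset.
Qed.

Lemma label_pair (I J : Type) (p : T -> I) (q : T -> J) :
  label p -> label q -> label (fun t => (p t, q t)).
Proof.
move=> mp mq [i j].
rewrite (_ : _ @^-1` _ = p @^-1` [set i] `&` q @^-1` [set j]).
  exact: measurableI.
by apply/seteqP; split=> [t [<- <-]|t [/= -> ->]].
Qed.

Lemma measurable_label (I : finType) (p : T -> I) (h : I -> R) :
  label p -> measurable_fun [set: T] (h \o p).
Proof.
by move=> mp _ Y _; rewrite setTI comp_preimage; apply: label_preimage.
Qed.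

Variable mu : {finite_measure set T -> \bar R}.

Lemma integral_label (I : finType) (p : T -> I) (h : I -> R) :
    label p -> (forall i, 0 <= h i) ->
  (\int[mu]_t (h (p t))%:E = (\sum_i h i * mass mu (p @^-1` [set i]))%:E)%E.
Proof.
move=> mp h0.
transitivity (\int[mu]_t (\sum_i (h i)%:E * (\1_(p @^-1` [set i]) t)%:E))%E.
  apply: eq_integral => t _; rewrite (bigD1 (p t)) //= indicE mem_set // mule1.
  rewrite big1 ?adde0 // => i ip; rewrite indicE memNset ?mule0 //= => e.
  by rewrite e eqxx in ip.
rewrite ge0_integral_sum //; first last.
- by move=> i t _; rewrite -EFinM lee_fin mulr_ge0.
- by move=> i; apply/measurable_EFinP/measurable_funM.
rewrite -sumEFin; apply: eq_bigr => i _.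
rewrite ge0_integralZl_EFin //; last exact/measurable_EFinP.
by rewrite integral_indic // setIT EFinM massE.
Qed.

Lemma mass_label (I : finType) (p : T -> I) (X : pred I) : label p ->
  mass mu (p @^-1` [set i | X i]) = \sum_(i | X i) mass mu (p @^-1` [set i]).
Proof.
move=> mp; apply: EFin_inj; have mX := label_preimage [set i | X i] mp.
rewrite massE //; transitivity (\int[mu]_t ((X (p t))%:R)%:E)%E.
  rewrite -[in LHS](setIT (p @^-1` _)) -integral_indic //.
  apply: eq_integral => t _; rewrite indicE; congr ((nat_of_bool _)%:R%:E).
  by apply/idP/idP => [/set_mem|h] //; exact/mem_set.
rewrite (integral_label (h := fun i => (X i)%:R) mp) // [in RHS]big_mkcond /=.
congr (_%:E); apply: eq_bigr => i _.
by case: (X i); rewrite ?mul1r ?mul0r.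
Qed.

Lemma sum_label (I : finType) (p : T -> I) : label p ->
  \sum_i mass mu (p @^-1` [set i]) = mass mu setT.
Proof. move=> mp; rewrite -(mass_label predT mp); congr (mass mu _).
by apply/seteqP. Qed.

Lemma round_down (f : T -> R) (M e : R) : measurable_fun setT f ->
    (forall t, 0 <= f t <= M) -> 0 < e ->
  exists n (k : T -> 'I_n.+1), label k /\
    forall t, (k t)%:R * e <= f t < (k t)%:R * e + e.
Proof.
move=> mf fM e0; pose n := Num.truncn (M / e).
have fe0 t : 0 <= f t / e by rewrite divr_ge0 ?(ltW e0) //; case/andP: (fM t).
have le_n t : (Num.truncn (f t / e) < n.+1)%N.
  rewrite ltnS; apply: le_truncn; rewrite ler_pM2r ?invr_gt0 //.
  by case/andP: (fM t).
exists n, (fun t => inord (Num.truncn (f t / e))); split=> [k|t]; last first.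
  rewrite inordK //; have /andP[lo hi] := truncn_itv (fe0 t).
  rewrite -ler_pdivlMr // lo /=.
  by rewrite -[X in _ + X]mul1r -mulrDl natr1 -ltr_pdivrMr.
rewrite (_ : _ @^-1` _ = f @^-1` `[k%:R * e, k.+1%:R * e[).
  by rewrite -[X in measurable X]setTI; apply: mf.
apply/seteqP; split => t /=; rewrite in_itv /=.
  move=> <-; rewrite inordK //; have /andP[lo hi] := truncn_itv (fe0 t).
  by rewrite -ler_pdivlMr // lo /= -ltr_pdivrMr.
rewrite -ler_pdivlMr // -ltr_pdivrMr // => lohi.
by apply: val_inj; rewrite /= inordK //; apply/eqP; rewrite truncn_eq.
Qed.

End labels.

(** * Approximation by rectangles and cyclic patterns *)

Section rectangles.
Context (R : realType) (d1 d2 : measure_display).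
Context (S : measurableType d1) (T : measurableType d2).
Variables (nu : {finite_measure set S -> \bar R}).
Variables (eta : {finite_measure set T -> \bar R}).
Local Notation mu := (finite_product nu eta).
Implicit Types E : set (S * T)%type.

(** [E] agrees with a union of rectangles of a finite grid outside a small set
    [N].  An exceptional set, rather than a symmetric difference, lets
    complements and unions be treated pointwise. *)
Definition rectangle_approximable E : Prop := measurable E /\
  forall e : R, 0 < e ->
  exists (I J : finType) (p : S -> I) (q : T -> J) (G : I -> J -> bool)
    (N : set (S * T)%type),
  [/\ label p, label q, measurable N, mass mu N < e &
      forall s t, ~ N (s, t) -> E (s, t) <-> G (p s) (q t)].

Lemma rectangle_approximableX (A : set S) (B : set T) :
  measurable A -> measurable B -> rectangle_approximable (A `*` B).
Proof.
move=> mA mB; split; first exact: measurableX.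
have lab d (X : measurableType d) (C : set X) :
    measurable C -> label (fun x => `[< C x >]).
  move=> mC [].
    by rewrite (_ : _ @^-1` _ = C) //; apply/seteqP; split=> x /asboolP.
  rewrite (_ : _ @^-1` _ = ~` C); first exact: measurableC.
  apply/seteqP; split=> x /=; last by move=> nC; rewrite asboolF.
  by move=> h Cx; move: h; rewrite asboolT.
move=> e e0.
exists bool, bool, (fun s => `[< A s >]), (fun t => `[< B t >]), andb, set0.
split; [exact: lab|exact: lab|by []|by rewrite mass0|].
move=> s t _; split=> [[/= As Bt]|/andP[/asboolP As /asboolP Bt]//].
by apply/andP; split; exact/asboolP.
Qed.

Lemma rectangle_approximableC E :
  rectangle_approximable E -> rectangle_approximable (~` E).
Proof.
move=> [mE aE]; split; first exact: measurableC.
move=> e /aE[I [J [p [q [G [N [mp mq mN Ne EG]]]]]]].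
exists I, J, p, q, (fun i j => ~~ G i j), N; split=> // s t /EG st.
by split=> [nE|/negP nG /st]; [apply/negP => /st|].
Qed.

Lemma rectangle_approximableU E F : rectangle_approximable E ->
  rectangle_approximable F -> rectangle_approximable (E `|` F).
Proof.
move=> [mE aE] [mF aF]; split; first exact: measurableU.
move=> e e0; have e20 : 0 < e / 2 by lra.
have [I [J [p [q [G [N [mp mq mN Ne EG]]]]]]] := aE _ e20.
have [I' [J' [p' [q' [G' [N' [mp' mq' mN' Ne' FG]]]]]]] := aF _ e20.
exists (I * I')%type, (J * J')%type,
  (fun s => (p s, p' s)), (fun t => (q t, q' t)),
  (fun i j => G i.1 j.1 || G' i.2 j.2), (N `|` N').
split; [exact: label_pair|exact: label_pair|exact: measurableU| |].
  by apply: le_lt_trans (massU_le mu mN mN') _; lra.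
move=> s t /not_orP[/EG st /FG st'] /=; split.
  by case=> [/st ->//|/st' ->]; rewrite orbT.
by case/orP => [/st|/st']; [left|right].
Qed.

Lemma rectangle_approximable_bigcup (F : (set (S * T)%type)^nat) :
  (forall n, rectangle_approximable (F n)) ->
  rectangle_approximable (\bigcup_n F n).
Proof.
move=> aF; have mF n : measurable (F n) by case: (aF n).
have aFn n : rectangle_approximable (\bigcup_(k < n) F k).
  elim: n => [|n IH].
    rewrite bigcup_mkord big_ord0 -(set0X setT).
    exact: rectangle_approximableX.
  rewrite bigcup_mkord big_ord_recr /= -bigcup_mkord.
  exact: rectangle_approximableU.
split; first exact: bigcupT_measurable.
move=> e e0; have e20 : 0 < e / 2 by lra.
have [n ne] := mass_bigcup_tail mu mF e20.
have [mFn /(_ _ e20)[I [J [p [q [G [N [mp mq mN Ne FG]]]]]]]] := aFn n.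
have mU : measurable (\bigcup_k F k `\` \bigcup_(k < n) F k).
  by apply: measurableD => //; exact: bigcupT_measurable.
exists I, J, p, q, G, (N `|` (\bigcup_k F k `\` \bigcup_(k < n) F k)).
split => //; first exact: measurableU.
  by rewrite (splitr e); apply: le_lt_trans (massU_le mu mN mU) (ltrD Ne ne).
move=> s t /not_orP[/FG st st']; rewrite -st; split; last first.
  by case=> k _ Fk; exists k.
by move=> Fst; apply: contrapT => nF; apply: st'.
Qed.

(** The approximable sets form a sigma-algebra containing the rectangles. *)
Lemma measurable_rectangle_approximable E :
  measurable E -> rectangle_approximable E.
Proof.
rewrite measurable_prod_measurableType; apply: smallest_sub; last first.
  by move=> _ [A mA] [B mB] <-; exact: rectangle_approximableX.
split.
- by rewrite -(set0X setT); exact: rectangle_approximableX.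
- by move=> F aF; rewrite setTD; exact: rectangle_approximableC.
- exact: rectangle_approximable_bigcup.
Qed.

End rectangles.

(** Translation by [x] is a bijection of the residues modulo [n.+1]. *)
Lemma card_latin (n k x : nat) : (k <= n.+1)%N ->
  #|[pred a : 'I_n.+1 | ((a + x) %% n.+1 < k)%N]| = k.
Proof.
move=> kn; pose y : 'I_n.+1 := inord (x %% n.+1).
have yE : y = (x %% n.+1)%N :> nat by rewrite inordK // ltn_mod.
transitivity #|[pred a : 'I_n.+1 | (a < k)%N]|; last first.
  rewrite -[RHS](card_ord k) -(card_codom (f := widen_ord kn)); last first.
    by move=> i j /(congr1 val) /= ij; exact: val_inj.
  apply: eq_card => a; rewrite inE; apply/idP/codomP => [ak|[i ->]] /=.
    by exists (Ordinal ak); exact: val_inj.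
  exact: ltn_ord.
rewrite -!sum1_card [RHS](reindex_inj (addIr y)) /=.
by apply: eq_bigl => a; rewrite !inE /= yE modnDmr.
Qed.

Section latin.
Context (R : realType) (d : measure_display) (T : measurableType d).
Variable mu : {finite_measure set T -> \bar R}.

(** Whatever the shift [x], exactly [k i] of the [n.+1] equal pieces of the
    class [i] are selected. *)
Lemma mass_latin (I : finType) (p : T -> I) n (P : T -> 'I_n.+1)
    (k : I -> nat) x :
    label p -> label P ->
    (forall i a, mass mu (p @^-1` [set i] `&` P @^-1` [set a])
       = mass mu (p @^-1` [set i]) / n.+1%:R) ->
    (forall i, k i <= n.+1)%N ->
  mass mu [set t | ((P t + x) %% n.+1 < k (p t))%N] =
  \sum_i mass mu (p @^-1` [set i]) * (k i)%:R / n.+1%:R.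
Proof.
move=> mp mP eqP kn.
pose X (ia : I * 'I_n.+1) := ((ia.2 + x) %% n.+1 < k ia.1)%N.
rewrite -[LHS](_ : mass mu ((fun t => (p t, P t)) @^-1` [set ia | X ia]) = _)
  //.
rewrite mass_label; last exact: label_pair.
transitivity (\sum_i \sum_(a | X (i, a))
    mass mu ((fun t => (p t, P t)) @^-1` [set (i, a)])).
  by rewrite pair_big_dep /=; apply: eq_big => [[i a]|[i a] _].
apply: eq_bigr => i _.
rewrite (eq_bigr (fun=> mass mu (p @^-1` [set i]) / n.+1%:R)); last first.
  move=> a _; rewrite -(eqP i a); congr (mass mu _).
  by apply/seteqP; split=> [t [<- <-]|t [/= -> ->]].
have Xcard : #|[pred a | X (i, a)]| = k i.
  by rewrite -[RHS](card_latin x (kn i)).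
rewrite sumr_const Xcard.
by rewrite -mulrnAl mulr_natr.
Qed.

End latin.

(** * Realizing a finite flow by a set *)

Lemma atomless_label_equipartition (R : realType) (d : measure_display)
    (T : measurableType d) (mu : {finite_measure set T -> \bar R})
    (I : finType) (p : T -> I) n : atomless mu -> label p ->
  exists P : T -> 'I_n.+1, label P /\ forall i a,
    mass mu (p @^-1` [set i] `&` P @^-1` [set a])
      = mass mu (p @^-1` [set i]) / n.+1%:R.
Proof.
move=> amu mp.
have /choice[Q QP] : forall i, exists Q : T -> 'I_n.+1, forall k,
    measurable (Q @^-1` [set k]) /\
    mass mu (p @^-1` [set i] `&` Q @^-1` [set k])
      = mass mu (p @^-1` [set i]) / n.+1%:R.
  by move=> i; exact: atomless_equipartition.
have PE i a : p @^-1` [set i] `&` (fun t => Q (p t) t) @^-1` [set a] =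
    p @^-1` [set i] `&` Q i @^-1` [set a].
  by apply/seteqP; split=> t [/= <-].
exists (fun t => Q (p t) t); split=> [a|i a]; last first.
  by rewrite PE; case: (QP i a).
rewrite (_ : _ @^-1` _ =
    \bigcup_(i in setT) (p @^-1` [set i] `&` Q i @^-1` [set a])).
  apply: fin_bigcup_measurable; first exact: finite_finset.
  by move=> i _; apply: measurableI => //; case: (QP i a).
apply/seteqP; split=> [t ta|t [i _ [/= <- //]]].
by exists (p t).
Qed.

Section flow_realization.
Context (R : realType) (d1 d2 : measure_display).
Context (S : measurableType d1) (T : measurableType d2).
Variables (nu : {finite_measure set S -> \bar R}).
Variables (eta : {finite_measure set T -> \bar R}).
Hypotheses (anu : atomless nu) (aeta : atomless eta).
Variables (I J : finType) (p : S -> I) (q : T -> J).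
Hypotheses (mp : label p) (mq : label q).

Local Notation a i := (mass nu (p @^-1` [set i])).
Local Notation w j := (mass eta (q @^-1` [set j])).

Variable v : I -> J -> R.
Hypothesis v0 : forall i j, 0 <= v i j <= a i * w j.

(** The flow [v] is turned into a set whose sections obey the same bounds as the
    rows and columns of [v].  A bound [r] on a section is inferred from the
    bound [r * w (q t)] on a column; classes of measure zero carry no flow and
    yield empty sections.  The last term is the loss from rounding the density
    down to a multiple of [n.+1%:R^-1]. *)
Lemma realize_flow n : exists F : set (S * T),
  [/\ measurable F, forall s t, F (s, t) -> v (p s) (q t) <> 0,
      forall t r, 0 <= r -> \sum_i v i (q t) <= r * w (q t) ->
        mass nu (ysection F t) <= r,
      forall s r, 0 <= r -> \sum_j v (p s) j <= r * a (p s) ->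
        mass eta (xsection F s) <= r &
      \sum_i \sum_j v i j - mass nu setT * mass eta setT / n.+1%:R
        <= mass (finite_product nu eta) F].
Proof.
have [P [mP aP]] := atomless_label_equipartition n anu mp.
have [Q [mQ aQ]] := atomless_label_equipartition n aeta mq.
set K : R := n.+1%:R.
have K0 : 0 < K by rewrite ltr0n.
(* If [a i * w j] is zero then so is the quotient, hence [k i j]. *)
pose k i j := Num.truncn (K * v i j / (a i * w j)).
have aw0 i j : 0 <= a i * w j by rewrite mulr_ge0 // mass_ge0.
have vaw i j : K * v i j / (a i * w j) * (a i * w j) = K * v i j.
  have [e|ne] := eqVneq (a i * w j) 0; last by rewrite divfK.
  have := v0 i j; rewrite e mulr0 -eq_le => /eqP <-.
  by rewrite mulr0.
have vaw0 i j : 0 <= K * v i j / (a i * w j).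
  by have /andP[v0' _] := v0 i j; rewrite divr_ge0 // mulr_ge0 // ltW.
have k_le i j : (k i j)%:R * (a i * w j) <= K * v i j.
  rewrite -vaw ler_wpM2r //; have /andP[] := truncn_itv (vaw0 i j).
  by [].
have k_ge i j : K * v i j <= (k i j)%:R * (a i * w j) + a i * w j.
  rewrite -vaw -[X in _ + X]mul1r -mulrDl ler_wpM2r // natr1 ltW //.
  by have /andP[] := truncn_itv (vaw0 i j).
have kK i j : (k i j <= n.+1)%N.
  rewrite -(ler_nat R); have /andP[+ _] := truncn_itv (vaw0 i j).
  move/le_trans; apply; rewrite -/K.
  have [e|ne] := eqVneq (a i * w j) 0; first by rewrite e invr0 mulr0 ltW.
  have aw_gt0 : 0 < a i * w j by rewrite lt_neqAle eq_sym ne aw0.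
  by rewrite ler_pdivrMr // ler_pM2l //; case/andP: (v0 i j).
have k0 i j : a i * w j = 0 -> k i j = 0%N.
  by move=> e; rewrite /k e invr0 mulr0 truncn0.
pose F :=
  [set st : S * T | ((P st.1 + Q st.2) %% n.+1 < k (p st.1) (q st.2))%N].
have yF t : mass nu (ysection F t) = \sum_i a i * (k i (q t))%:R / K.
  rewrite -(mass_latin (k := fun i => k i (q t)) (Q t) mp mP aP) //.
  by congr (mass nu _); apply/seteqP; split=> s; rewrite /ysection /= inE.
have xF s : mass eta (xsection F s) = \sum_j w j * (k (p s) j)%:R / K.
  rewrite -(mass_latin (k := fun j => k (p s) j) (P s) mq mQ aQ) //.
  congr (mass eta _); apply/seteqP.
  by split=> t; rewrite /xsection /= inE /= addnC.
have mF : measurable F.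
  have lfst (X : Type) (f : S -> X) :
      label f -> label (fun st : S * T => f st.1).
    move=> mf x; rewrite -[X in measurable X]setTI.
    exact: (@measurable_fst _ _ S T measurableT _ (mf x)).
  have lsnd (X : Type) (f : T -> X) :
      label f -> label (fun st : S * T => f st.2).
    move=> mf x; rewrite -[X in measurable X]setTI.
    exact: (@measurable_snd _ _ S T measurableT _ (mf x)).
  have mz := label_pair (label_pair (lfst _ _ mp) (lfst _ _ mP))
    (label_pair (lsnd _ _ mq) (lsnd _ _ mQ)).
  exact: (label_preimage
    [set z : (I * 'I_n.+1) * (J * 'I_n.+1) |
      ((z.1.2 + z.2.2) %% n.+1 < k z.1.1 z.2.1)%N] mz).
exists F; split => //.
- move=> s t; rewrite /F /= => kF v_eq0; move: kF.
  by rewrite /k v_eq0 mulr0 mul0r truncn0.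
- move=> t r r0 vr; rewrite yF.
  have [w_eq0|w_neq0] := eqVneq (w (q t)) 0.
    by rewrite big1 // => i _; rewrite k0 ?mulr0 ?mul0r // w_eq0 mulr0.
  have w_gt0 : 0 < w (q t) by rewrite lt_neqAle eq_sym w_neq0 mass_ge0.
  rewrite -(ler_pM2r w_gt0); apply: le_trans vr; rewrite mulr_suml.
  apply: ler_sum => i _; have := k_le i (q t).
  by rewrite mulrAC ler_pdivrMr // mulrAC mulrC [_ * K]mulrC mulrC.
- move=> s r r0 vr; rewrite xF.
  have [a_eq0|a_neq0] := eqVneq (a (p s)) 0.
    by rewrite big1 // => i _; rewrite k0 ?mulr0 ?mul0r // a_eq0 mul0r.
  have a_gt0 : 0 < a (p s) by rewrite lt_neqAle eq_sym a_neq0 mass_ge0.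
  rewrite -(ler_pM2r a_gt0); apply: le_trans vr; rewrite mulr_suml.
  apply: ler_sum => j _; have := k_le (p s) j.
  by rewrite mulrAC ler_pdivrMr // [_ * K]mulrC; congr (_ <= _); ring.
- have -> : mass (finite_product nu eta) F =
      \sum_i \sum_j (k i j)%:R * (a i * w j) / K.
    apply: EFin_inj; rewrite massE // /finite_product /product_measure1.
    transitivity (\int[nu]_s (\sum_j w j * (k (p s) j)%:R / K)%:E)%E.
      apply: eq_integral => s _ /=; rewrite -xF massE //.
      exact: measurable_xsection.
    rewrite (integral_label nu (h := fun i => \sum_j w j * (k i j)%:R / K) mp);
      last first.
      move=> i; apply: sumr_ge0 => j _.
      by rewrite mulr_ge0 ?invr_ge0 ?(ltW K0) // mulr_ge0 ?mass_ge0.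
    congr (_%:E); apply: eq_bigr => i _; rewrite mulr_suml.
    by apply: eq_bigr => j _; ring.
  rewrite -(sum_label nu mp) -(sum_label eta mq) -subr_ge0.
  rewrite big_distrlr /= mulr_suml opprB addrA -big_split -sumrB /=.
  apply: sumr_ge0 => i _; rewrite mulr_suml -big_split -sumrB /=.
  apply: sumr_ge0 => j _; rewrite -mulrDl subr_ge0 ler_pdivlMr // mulrC.
  exact: k_ge.
Qed.

End flow_realization.

(** * Sets of nearly optimal measure *)

Section degree.
Context (R : realType) (d1 d2 : measure_display).
Context (S : measurableType d1) (T : measurableType d2).
Variables (eta : {finite_measure set T -> \bar R}).
Implicit Types (E : set (S * T)) (A : set T).

Lemma degreeE E A s : degree eta E A s = eta (xsection (E `&` snd @^-1` A) s).
Proof.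
by congr (eta _); apply/seteqP; split=> t; rewrite /xsection /= !inE.
Qed.

Lemma measurableI_snd E A : measurable E -> measurable A ->
  measurable (E `&` snd @^-1` A).
Proof.
move=> mE mA; apply: measurableI => //.
rewrite -[X in measurable X]setTI.
exact: (@measurable_snd _ _ S T measurableT _ mA).
Qed.

Lemma measurable_degree E A : measurable E -> measurable A ->
  measurable_fun [set: S] (degree eta E A).
Proof.
move=> mE mA; rewrite (_ : degree _ _ _ = eta \o xsection (E `&` snd @^-1` A)).
  by apply: measurable_fun_xsection; exact: measurableI_snd.
by apply/funext => s; rewrite degreeE.
Qed.

Lemma mass_degree E A s : measurable E -> measurable A ->
  degree eta E A s = (mass eta (xsection E s `&` A))%:E.
Proof.
move=> mE mA; rewrite massE //; apply: measurableI => //.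
exact: measurable_xsection.
Qed.

End degree.

Lemma min_perturb (R : realDomainType) (c x k y e z : R) :
    c <= k + e -> x <= y + z -> 0 <= e -> 0 <= z ->
  Num.min c x <= Num.min k y + e + z.
Proof. by case: (leP c x) => ?; case: (leP k y) => ?; lra. Qed.

Section discretized_cut.
Context (R : realType) (d1 d2 : measure_display).
Context (S : measurableType d1) (T : measurableType d2).
Variables (nu : {finite_measure set S -> \bar R}).
Variables (eta : {finite_measure set T -> \bar R}).
Variables (I J : finType) (p : S -> I) (q : T -> J).
Hypotheses (mp : label p) (mq : label q).

Local Notation a i := (mass nu (p @^-1` [set i])).
Local Notation w j := (mass eta (q @^-1` [set j])).

Variables (E N : set (S * T)) (G : I -> J -> bool).
Hypotheses (mE : measurable E) (mN : measurable N).
Hypothesis EG : forall s t, ~ N (s, t) -> E (s, t) <-> G (p s) (q t).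
Variables (b : T -> R) (c : S -> R) (beta : J -> R) (gamma : I -> R) (e : R).
Hypotheses (mb : measurable_fun [set: T] b) (mc : measurable_fun [set: S] c).
Hypotheses (b0 : forall t, 0 <= b t) (c0 : forall s, 0 <= c s).
Hypotheses (beta0 : forall j, 0 <= beta j) (gamma0 : forall i, 0 <= gamma i).
Hypotheses (b_le : forall t, b t <= beta (q t) + e).
Hypotheses (c_le : forall s, c s <= gamma (p s) + e).
Hypothesis (e0 : 0 <= e).

(** Compare integrands: [b] exceeds [beta \o q] by at most [e], [c] exceeds
    [gamma \o p] by at most [e], and the degree in [E] exceeds the degree in the
    grid by at most the measure of the section of [N], which integrates to the
    measure of [N]. *)
Lemma discretized_cut (A : {set J}) :
  (cut_value nu eta E b c (q @^-1` [set j | j \in A]) <=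
   (finite_cut (fun j => beta j * w j) (fun i => gamma i * a i)
      (fun i j => (G i j)%:R * (a i * w j)) A
    + (e * mass eta setT + e * mass nu setT
       + mass (finite_product nu eta) N))%:E)%E.
Proof.
set A' := q @^-1` _.
have mA' : measurable A' by exact: label_preimage.
have bpart : (\int[eta]_(t in ~` A') (b t)%:E <=
    (\sum_(j in ~: A) beta j * w j + e * mass eta setT)%:E)%E.
  pose h j := if j \in A then 0 else beta j + e.
  have h0 j : 0 <= h j by rewrite /h; case: ifP => // _; rewrite addr_ge0.
  apply: (@le_trans _ _ (\int[eta]_t (h (q t))%:E)%E).
    rewrite integral_mkcond; apply: ge0_le_integral => //=.
    - by move=> t _; rewrite /patch; case: ifP => // _; rewrite lee_fin.
    - apply/(measurable_restrictT _ (measurableC mA')).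
      by apply: measurable_funTS; apply/measurable_EFinP.
    - by apply/measurable_EFinP; exact: measurable_label.
    - move=> t _; rewrite /patch; case: ifPn => [|_]; last by rewrite lee_fin.
      by rewrite inE /A' /= /h => /negP/negPf->; rewrite lee_fin.
  rewrite (integral_label eta mq) // lee_fin.
  rewrite -(sum_label eta mq) mulr_sumr [X in _ <= X + _]big_mkcond -big_split.
  apply: ler_sum => j _ /=; rewrite inE /h; case: ifP => _ /=.
    by rewrite mul0r add0r mulr_ge0 ?mass_ge0.
  by rewrite mulrDl.
have cpart : (\int[nu]_s Order.min (c s)%:E (degree eta E A' s) <=
    (\sum_i Num.min (gamma i * a i)
       (load (fun i j => (G i j)%:R * (a i * w j)) A i)
     + e * mass nu setT + mass (finite_product nu eta) N)%:E)%E.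
  pose y i := \sum_(j in A) (G i j)%:R * w j.
  pose h i := Num.min (gamma i) (y i) + e.
  have y0 i : 0 <= y i.
    by apply: sumr_ge0 => j _; rewrite mulr_ge0 // mass_ge0.
  have h0 i : 0 <= h i by rewrite addr_ge0 // le_min gamma0 y0.
  apply: (@le_trans _ _ (\int[nu]_s ((h (p s))%:E + eta (xsection N s)))%E).
    apply: ge0_le_integral => //=.
    - by move=> s _; rewrite le_min lee_fin c0 /=; exact: measure_ge0.
    - apply: measurable_mine; first exact/measurable_EFinP.
      exact: measurable_degree.
    - apply: emeasurable_funD; last exact: measurable_fun_xsection.
      by apply/measurable_EFinP; exact: measurable_label.
    - move=> s _; rewrite mass_degree // -EFin_min.
      have mNs : measurable (xsection N s) by exact: measurable_xsection.
      rewrite -massE // -EFinD lee_fin.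
      have : mass eta (xsection E s `&` A')
          <= y (p s) + mass eta (xsection N s).
        have -> : y (p s) = mass eta (q @^-1` [set j | (j \in A) && G (p s) j]).
          rewrite (mass_label eta (fun j => (j \in A) && G (p s) j) mq).
          rewrite big_mkcondr.
          apply: eq_bigr => j _; case: (G _ _); by rewrite ?mul1r ?mul0r.
        have mAG := label_preimage [set j | (j \in A) && G (p s) j] mq.
        apply: le_trans (massU_le _ mAG mNs).
        apply: mass_le; first exact/measurableI/mA'/measurable_xsection.
          exact: measurableU.
        move=> t [+ At]; rewrite /xsection /= !inE => Est.
        have [Nst|nNst] := pselect (N (s, t)); [by right|left].
        by apply/andP; split => //; exact/(EG nNst).
      by move=> le_y; rewrite /h; apply: min_perturb => //; exact: mass_ge0.
  rewrite ge0_integralD //=; first last.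
  - exact: measurable_fun_xsection.
  - by apply/measurable_EFinP; exact: measurable_label.
  - by move=> s _; rewrite lee_fin.
  rewrite (integral_label nu mp) // EFinD massE //; apply: leeD => //.
  rewrite lee_fin -(sum_label nu mp) mulr_sumr -big_split /=.
  apply: ler_sum => i _; rewrite mulrDl lerD2r minr_pMl ?mass_ge0 //.
  rewrite /load /y mulr_suml; under eq_bigr do rewrite -mulrA [_ * a i]mulrC.
  by [].
rewrite /cut_value; apply: le_trans (leeD bpart cpart) _.
rewrite -EFinD lee_fin /finite_cut; move: (mass (finite_product nu eta) N) => z.
by lra.
Qed.

End discretized_cut.

Section near_optimal.
Context (R : realType) (d1 d2 : measure_display).
Context (S : measurableType d1) (T : measurableType d2).
Variables (nu : {finite_measure set S -> \bar R}).
Variables (eta : {finite_measure set T -> \bar R}).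
Hypotheses (anu : atomless nu) (aeta : atomless eta).
Variables (b : T -> R) (c : S -> R).
Hypotheses (mb : measurable_fun [set: T] b) (mc : measurable_fun [set: S] c).
Hypothesis hb : forall t, 0 <= b t <= mass nu setT.
Hypothesis hc : forall s, 0 <= c s <= mass eta setT.
Variables (E : set (S * T)) (mE : measurable E).

(** The discretization of width [r] costs [r * (eta T + nu S)] in the rounding
    of [b] and [c], less than [r] twice for the exceptional set [N] (once in the
    cuts, once when [N] is removed from the final set), and at most
    [r * (nu S * eta T)] in the rounding of the densities; the constant [C] adds
    these up. *)
Lemma near_optimal_admissible (m e : R) : 0 < e ->
    (forall A, measurable A -> (m%:E <= cut_value nu eta E b c A)%E) ->
  exists F, admissible nu eta E b c F /\
    m - e <= mass (finite_product nu eta) F.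
Proof.
move=> e0 mcut.
pose nT := mass nu setT; pose eT := mass eta setT.
have nT0 : 0 <= nT by exact: mass_ge0.
have eT0 : 0 <= eT by exact: mass_ge0.
pose C := eT + nT + 2 + nT * eT.
have C0 : 0 < C by rewrite /C; have := mulr_ge0 nT0 eT0; lra.
pose r := e / C.
have r0 : 0 < r by rewrite divr_gt0.
have [_ /(_ _ r0)[I0 [J0 [p0 [q0 [G [N [mp0 mq0 mN Nr EG]]]]]]]] :=
  measurable_rectangle_approximable nu eta mE.
have [nb [kb [mkb kbP]]] := round_down mb hb r0.
have [nc [kc [mkc kcP]]] := round_down mc hc r0.
pose p s := (p0 s, kc s); have mp : label p by exact: label_pair.
pose q t := (q0 t, kb t); have mq : label q by exact: label_pair.
pose gamma (i : I0 * 'I_nc.+1) : R := i.2%:R * r.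
pose beta (j : J0 * 'I_nb.+1) : R := j.2%:R * r.
have gamma0 i : 0 <= gamma i by rewrite mulr_ge0 // ltW.
have beta0 j : 0 <= beta j by rewrite mulr_ge0 // ltW.
pose a i := mass nu (p @^-1` [set i]).
pose w j := mass eta (q @^-1` [set j]).
pose u (i : I0 * 'I_nc.+1) (j : J0 * 'I_nb.+1) : R :=
  (G i.1 j.1)%:R * (a i * w j).
have aw0 i j : 0 <= a i * w j by rewrite mulr_ge0 // mass_ge0.
have u0 i j : 0 <= u i j by rewrite mulr_ge0.
pose mu := mass (finite_product nu eta).
pose m' := m - (r * eT + r * nT + mu N).
have cut_ge A : m' <= finite_cut (fun j => beta j * w j)
    (fun i => gamma i * a i) u A.
  rewrite lerBlDr -lee_fin.
  apply: le_trans (mcut _ (label_preimage [set j | j \in A] mq)) _.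
  have b0 t : 0 <= b t by case/andP: (hb t).
  have c0 s : 0 <= c s by case/andP: (hc s).
  have b_le t : b t <= beta (q t) + r by apply: ltW; case/andP: (kbP t).
  have c_le s : c s <= gamma (p s) + r by apply: ltW; case/andP: (kcP s).
  exact: (@discretized_cut _ _ _ _ _ nu eta _ _ p q mp mq E N
    (fun i j => G i.1 j.1) mE mN EG b c beta gamma r mb mc b0 c0 beta0 gamma0
    b_le c_le (ltW r0) A).
have [v [vu rowv colv valv]] := finite_max_flow
  (fun i => mulr_ge0 (gamma0 i) (mass_ge0 nu _))
  (fun j => mulr_ge0 (beta0 j) (mass_ge0 eta _)) u0 cut_ge.
have vaw i j : 0 <= v i j <= a i * w j.
  have /andP[-> /le_trans /=] := vu i j; apply.
  by rewrite /u; case: (G _ _); rewrite ?mul1r ?mul0r.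
pose n := Num.bound r^-1.
have nr : n.+1%:R^-1 <= r.
  rewrite invf_ple ?posrE //; apply: ltW; apply: lt_trans (_ : n%:R < _).
    by apply: archi_boundP; rewrite invr_ge0 ltW.
  by rewrite ltr_nat.
have [F [mF Fv yF xF valF]] := realize_flow anu aeta mp mq vaw n.
have mFN : measurable (F `\` N) by exact: measurableD.
exists (F `\` N); split.
  split => //.
  - move=> [s t] [/Fv vst /EG ->].
    move/eqP: vst; have := vu (p s) (q t); rewrite /u /=.
    case: (G _ _) => //; rewrite mul0r -eq_le eq_sym => /eqP ->.
    by rewrite eqxx.
  - apply: aeW => t /=; rewrite -massE; last exact: measurable_ysection.
    rewrite lee_fin.
    apply: (@le_trans _ _ (mass nu (ysection F t))).
      apply: mass_le; [exact: measurable_ysection..|].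
      by apply: le_ysection; exact: subDsetl.
    apply: (@le_trans _ _ (beta (q t))); last by case/andP: (kbP t).
    by apply: yF => //; exact: colv.
  - apply: aeW => s /=; rewrite -massE; last exact: measurable_xsection.
    rewrite lee_fin.
    apply: (@le_trans _ _ (mass eta (xsection F s))).
      apply: mass_le; [exact: measurable_xsection..|].
      by apply: le_xsection; exact: subDsetl.
    apply: (@le_trans _ _ (gamma (p s))); last by case/andP: (kcP s).
    by apply: xF => //; exact: rowv.
have FN : mu F <= mu (F `\` N) + mu N.
  apply: le_trans (massU_le _ mFN mN); apply: mass_le => //.
    exact: measurableU.
  by move=> z Fz; have [Nz|nNz] := pselect (N z); [right|left].
have : e = r * C by rewrite /r divfK // gt_eqF.
have : nT * eT / n.+1%:R <= nT * eT * r by rewrite ler_wpM2l // mulr_ge0.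
move: FN valF valv Nr; rewrite -/mu -/nT -/eT /m' /C.
move: (mu F) (mu (F `\` N)) (mu N) (\sum_i _) => x y z f.
rewrite !mulrDr mulr1 (mulrC r (nT * eT)).
move: (nT * eT / n.+1%:R) (nT * eT * r) (r * eT) (r * nT) => g1 g2 g3 g4.
lra.
Qed.

End near_optimal.

(** * Minimizing a submodular set function *)

Section submodular_minimum.
Context (R : realType) (d : measure_display) (T : measurableType d).
Variable eta : {finite_measure set T -> \bar R}.
Variables (f : set T -> R) (L : R).
Hypothesis L0 : 0 <= L.
Hypothesis f0 : forall A, measurable A -> 0 <= f A.
Hypothesis f_submod : forall A B, measurable A -> measurable B ->
  f (A `|` B) + f (A `&` B) <= f A + f B.
Hypothesis f_lip : forall A B, measurable A -> measurable B ->
  f A <= f B + L * (mass eta (A `\` B) + mass eta (B `\` A)).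

(** Choose [A n] with [f (A n) < m + 2^-1 ^+ n.+1].  Since intersections have
    value at least the infimum [m], submodularity bounds finite unions of the
    [A n] with [n >= k] by [m + 2^-1 ^+ k]; by continuity the same bound holds
    for the full union [B k], and the intersection [C] of the [B k] attains
    [m]. *)
Lemma submodular_attains_minimum :
  exists A, measurable A /\ forall B, measurable B -> f A <= f B.
Proof.
pose V := f @` (@measurable _ T); pose m := inf V.
have lbV : has_lbound V by exists 0 => _ [A mA <-]; exact: f0.
have infV : has_inf V by split => //; exists (f set0), set0.
have m_le A : measurable A -> m <= f A.
  by move=> mA; apply: ge_inf => //; exists A.
suff [A [mA fA]] : exists A, measurable A /\ f A <= m.
  by exists A; split => // B mB; apply: le_trans fA (m_le _ mB).
have /choice[A AP] : forall n : nat,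
    exists A, measurable A /\ f A < m + 2^-1 ^+ n.+1.
  move=> n; have [|_ [A mA <-] fA] := @inf_adherent _ V (2^-1 ^+ n.+1) _ infV.
    by rewrite exprn_gt0.
  by exists A.
have mA n : measurable (A n) by case: (AP n).
have close x y r :
    0 < r -> (forall e, 0 < e -> e <= r -> x <= y + L * e) -> x <= y.
  move=> r0 h; apply/ler_addgt0Pr => e e0.
  pose e' := Num.min r (e / (L + 1)).
  have L1 : 0 < L + 1 by exact: ltr_wpDl.
  have e'0 : 0 < e' by rewrite lt_min r0 divr_gt0.
  apply: le_trans (h e' e'0 _) _; first by rewrite ge_min lexx.
  rewrite lerD2l; apply: (@le_trans _ _ ((L + 1) * e')).
    by rewrite ler_pM2r // lerDl.
  by rewrite mulrC -ler_pdivlMr // ge_min lexx orbT.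
pose U k n := \bigcup_(i < n) A (k + i)%N.
have mU k n : measurable (U k n) by exact: bigcup_measurable.
have fU k n : f (U k n.+1) <= m + 2^-1 ^+ k * (1 - 2^-1 ^+ n.+1).
  elim: n => [|n IH].
    rewrite /U bigcup_mkord big_ord1 addn0; have [_ /ltW] := AP k.
    by rewrite expr1 exprS; lra.
  rewrite {1}/U bigcup_mkord big_ord_recr /=.
  rewrite -(bigcup_mkord _ (fun i => A (k + i)%N)) -/(U k n.+1).
  have := f_submod (mU k n.+1) (mA (k + n.+1)%N).
  have := m_le _ (measurableI _ _ (mU k n.+1) (mA (k + n.+1)%N)).
  have [_ /ltW] := AP (k + n.+1)%N.
  rewrite -addnS exprD [_ ^+ n.+2]exprS; move: IH.
  move: (2^-1 ^+ k) (2^-1 ^+ n.+1) => x y.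
  lra.
pose B k := \bigcup_i A (k + i)%N.
have mB k : measurable (B k) by exact: bigcupT_measurable.
have fB k : f (B k) <= m + 2^-1 ^+ k.
  apply: (close _ _ 1) => // e e0 _.
  have [n] := mass_bigcup_tail eta (fun i => mA (k + i)%N) e0.
  rewrite -/(B k) => ne.
  have UB : U k n.+1 `<=` B k by apply: bigcup_subset => i.
  have := f_lip (mB k) (mU k n.+1).
  have -> : U k n.+1 `\` B k = set0 by rewrite setD_eq0.
  rewrite mass0 addr0.
  have : mass eta (B k `\` U k n.+1) <= e.
    apply: le_trans (ltW ne); apply: mass_le.
    - exact: measurableD.
    - apply: measurableD => //; exact: bigcup_measurable.
    - by apply: setDS; apply: bigcup_subset => i /= /ltn_trans; apply.
  move=> /(ler_wpM2l L0); have := fU k n.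
  have : 0 <= 2^-1 ^+ k * 2^-1 ^+ n.+1 :> R by rewrite mulr_ge0 // exprn_ge0.
  rewrite mulrBr mulr1; lra.
pose C := \bigcap_k B k.
have mC : measurable C by exact: bigcapT_measurable.
exists C; split => //.
have ndB : nondecreasing_seq (fun k => ~` B k).
  apply/nondecreasing_seqP => n; apply/subsetPset; apply: subsetC => x [i _ Ai].
  by exists i.+1 => //; rewrite addnS.
apply: (close _ _ 1) => // e e0 _.
apply/ler_addgt0Pr => r r0.
have tail := mass_ndseq_tail eta (fun k => measurableC (mB k)) ndB e0.
have half : \forall k \near \oo, 2^-1 ^+ k < r :> R.
  have : (2^-1 ^+ k : R) @[k --> \oo] --> 0.
    by apply: cvg_expr; rewrite ger0_norm // invf_lt1 // ltr1n.
  move/cvgrPdist_lt => /(_ _ r0); apply: filterS => k.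
  by rewrite sub0r normrN ger0_norm // exprn_ge0.
have [k [tailk rk]] := @filter_ex _ _ _ _ (filterI tail half).
have := f_lip mC (mB k).
have CB : C `<=` B k by exact: bigcap_inf.
have -> : C `\` B k = set0 by rewrite setD_eq0.
rewrite mass0 add0r.
have -> : B k `\` C = \bigcup_k0 (~` B k0) `\` ~` B k.
  by rewrite -setC_bigcap !setDE setCK setIC.
have := ler_wpM2l L0 (ltW tailk).
have := fB k; lra.
Qed.

End submodular_minimum.

(** * Cuts *)

Lemma ge0_le_integralDD (R : realType) (d : measure_display)
    (T : measurableType d) (mu : {measure set T -> \bar R})
    (f1 f2 g1 g2 : T -> \bar R) :
    (forall t, 0 <= f1 t)%E -> (forall t, 0 <= f2 t)%E ->
    (forall t, 0 <= g1 t)%E -> (forall t, 0 <= g2 t)%E ->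
    measurable_fun setT f1 -> measurable_fun setT f2 ->
    measurable_fun setT g1 -> measurable_fun setT g2 ->
    (forall t, f1 t + f2 t <= g1 t + g2 t)%E ->
  (\int[mu]_t f1 t + \int[mu]_t f2 t <= \int[mu]_t g1 t + \int[mu]_t g2 t)%E.
Proof.
move=> f10 f20 g10 g20 mf1 mf2 mg1 mg2 fg.
rewrite -!ge0_integralD //; apply: ge0_le_integral => //.
- by move=> t _; rewrite adde_ge0.
- exact: emeasurable_funD.
- exact: emeasurable_funD.
Qed.

Section cut.
Context (R : realType) (d1 d2 : measure_display).
Context (S : measurableType d1) (T : measurableType d2).
Variables (nu : {finite_measure set S -> \bar R}).
Variables (eta : {finite_measure set T -> \bar R}).
Variables (b : T -> R) (c : S -> R).
Hypotheses (mb : measurable_fun [set: T] b) (mc : measurable_fun [set: S] c).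
Hypothesis hb : forall t, 0 <= b t <= mass nu setT.
Hypothesis hc : forall s, 0 <= c s <= mass eta setT.
Variables (E : set (S * T)) (mE : measurable E).

Let b0 t : 0 <= b t. Proof. by case/andP: (hb t). Qed.
Let c0 s : 0 <= c s. Proof. by case/andP: (hc s). Qed.

(** The two integrands of a cut, both over the whole space, so that cuts can be
    compared pointwise. *)
Let bout (A : set T) : T -> R := b \_ (~` A).
Let cin (A : set T) s : \bar R := Order.min (c s)%:E (degree eta E A s).

Let boutE A t : bout A t = if t \in A then 0 else b t.
Proof. by rewrite /bout /patch in_setC; case: (t \in A). Qed.

Let bout_ge0 A t : (0 <= (bout A t)%:E)%E.
Proof. by rewrite boutE; case: ifP => _; rewrite lee_fin. Qed.

Let cin_ge0 A s : (0 <= cin A s)%E.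
Proof. by rewrite /cin le_min lee_fin c0 /=; exact: measure_ge0. Qed.

Let cut_valueE A :
  cut_value nu eta E b c A =
    (\int[eta]_t (bout A t)%:E + \int[nu]_s cin A s)%E.
Proof.
congr (_ + _)%E; rewrite integral_mkcond; apply: eq_integral => t _.
by rewrite /bout /patch; case: (t \in _).
Qed.

Let measurable_bout A : measurable A -> measurable_fun setT (EFin \o bout A).
Proof.
move=> mA; apply/measurable_EFinP/(measurable_restrictT _ (measurableC mA)).
exact: measurable_funTS.
Qed.

Let measurable_cin A : measurable A -> measurable_fun setT (cin A).
Proof.
move=> mA; apply: measurable_mine; first exact/measurable_EFinP.
exact: measurable_degree.
Qed.

Lemma cut_value_fin_num A : measurable A ->
  cut_value nu eta E b c A \is a fin_num.
Proof.
move=> mA; rewrite cut_valueE fin_numD; apply/andP; split.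
  rewrite ge0_fin_numE; last exact: integral_ge0.
  apply: (@le_lt_trans _ _ (\int[eta]_t (cst (mass nu setT)%:E t))%E).
    apply: ge0_le_integral => //; first exact: measurable_bout.
    move=> t _; rewrite lee_fin boutE.
    by case: ifP => _; [exact: mass_ge0|case/andP: (hb t)].
  by rewrite integral_cst // ltey_eq fin_numM // fin_num_measure.
rewrite ge0_fin_numE; last exact: integral_ge0.
apply: (@le_lt_trans _ _ (\int[nu]_s (cst (mass eta setT)%:E s))%E).
  apply: ge0_le_integral => //; first exact: measurable_cin.
  move=> s _; rewrite /cin ge_min lee_fin; apply/orP; left.
  by case/andP: (hc s).
by rewrite integral_cst // ltey_eq fin_numM // fin_num_measure.
Qed.

Lemma cut_value_submod A B : measurable A -> measurable B ->
  (cut_value nu eta E b c (A `|` B) + cut_value nu eta E b c (A `&` B)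
    <= cut_value nu eta E b c A + cut_value nu eta E b c B)%E.
Proof.
move=> mA mB.
have mU := measurableU _ _ mA mB; have mI := measurableI _ _ mA mB.
rewrite !cut_valueE addeACA [leRHS]addeACA; apply: leeD.
  apply: ge0_le_integralDD => //; try exact: measurable_bout.
  move=> t; rewrite -!EFinD lee_fin !boutE in_setU in_setI.
  by case: (t \in A); case: (t \in B) => /=; rewrite ?addr0 ?add0r.
apply: ge0_le_integralDD => //; try exact: measurable_cin.
move=> s; rewrite /cin !mass_degree // -!EFin_min -!EFinD lee_fin.
have mEs : measurable (xsection E s) by exact: measurable_xsection.
have mEA C : measurable C -> measurable (xsection E s `&` C).
  exact: measurableI.
apply: min_submod; first last.
- by apply: mass_le; [exact: mEA|exact: mEA|move=> t [? []]].
- by apply: mass_le; [exact: mEA|exact: mEA|move=> t [? []]].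
by rewrite setIUr setIIr; apply: massUI; exact: mEA.
Qed.

Lemma cut_value_lipschitz A B : measurable A -> measurable B ->
  (cut_value nu eta E b c A <= cut_value nu eta E b c B
    + (mass nu setT * (mass eta (A `\` B) + mass eta (B `\` A)))%:E)%E.
Proof.
move=> mA mB; have mAB := measurableD mA mB; have mBA := measurableD mB mA.
rewrite !cut_valueE mulrDr EFinD [X in (_ <= _ + X)%E]addeC.
rewrite (addeACA (\int[eta]_t (bout B t)%:E)%E).
have zero d (X : measurableType d) (mu : {measure set X -> \bar R}) :
  (\int[mu]_x (cst 0 x) = 0)%E by exact: integral0.
apply: leeD.
  have -> : (mass nu setT * mass eta (B `\` A))%:E =
      (\int[eta]_t ((mass nu setT)%:E * (\1_(B `\` A) t)%:E))%E.
    rewrite ge0_integralZl_EFin ?mass_ge0 //; last exact/measurable_EFinP.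
    by rewrite integral_indic // setIT EFinM (massE eta).
  rewrite -[leLHS]adde0 -(zero _ _ eta); apply: ge0_le_integralDD => //.
  - by move=> t; rewrite mule_ge0 // lee_fin ?mass_ge0.
  - exact: measurable_bout.
  - exact: measurable_bout.
  - by apply: measurable_funeM; exact/measurable_EFinP.
  move=> t; rewrite adde0 -EFinM -EFinD lee_fin !boutE indicE in_setD.
  have := b0 t; have := hb t; have := mass_ge0 nu setT.
  by case: (t \in A); case: (t \in B) => /= ? /andP[? ?] ?;
    rewrite ?mulr0 ?mulr1 ?addr0 ?add0r.
have -> : (mass nu setT * mass eta (A `\` B))%:E =
    (\int[nu]_s (cst (mass eta (A `\` B))%:E s))%E.
  by rewrite integral_cst // EFinM (massE nu) // muleC.
rewrite -[leLHS]adde0 -(zero _ _ nu); apply: ge0_le_integralDD => //.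
- by move=> s; rewrite lee_fin mass_ge0.
- exact: measurable_cin.
- exact: measurable_cin.
move=> s; rewrite adde0 /cin !mass_degree // -!EFin_min -EFinD lee_fin /cst.
have mEs : measurable (xsection E s) by exact: measurable_xsection.
rewrite -[X in X + _]addr0; apply: min_perturb => //; first by rewrite addr0.
  apply: le_trans (massU_le _ (measurableI _ _ mEs mB) mAB).
  apply: mass_le; [exact: measurableI| |].
    by apply: measurableU => //; exact: measurableI.
  move=> t [Est At]; have [Bt|nBt] := pselect (B t); [by left|by right].
exact: mass_ge0.
Qed.

Lemma exists_minimal_cut : exists A, measurable A /\
  forall B, measurable B ->
    (cut_value nu eta E b c A <= cut_value nu eta E b c B)%E.
Proof.
pose f A := fine (cut_value nu eta E b c A).
have fE A : measurable A -> (f A)%:E = cut_value nu eta E b c A.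
  by move=> mA; rewrite fineK // cut_value_fin_num.
have [||A mA B mB|A B mA mB|A [mA minA]] :=
  @submodular_attains_minimum _ _ _ eta f (mass nu setT).
- exact: mass_ge0.
- move=> A mA; rewrite -lee_fin fE // cut_valueE adde_ge0 //.
    exact: integral_ge0.
  exact: integral_ge0.
- rewrite -lee_fin !EFinD !fE //; [exact: cut_value_submod|exact: measurableI|].
  exact: measurableU.
- by rewrite -lee_fin EFinD !fE //; exact: cut_value_lipschitz.
by exists A; split => // B mB; rewrite -!fE // lee_fin minA.
Qed.

Lemma product_ysection F : measurable F ->
  (finite_product nu eta F = \int[eta]_t nu (ysection F t))%E.
Proof.
move=> mF; have := indic_fubini_tonelli nu eta mF.
by rewrite indic_fubini_tonelli_FE // indic_fubini_tonelli_GE.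
Qed.

(** Weak duality: the part of [F] over the complement of [A] is integrated along
    the sections [F_t], the part over [A] along the sections [F^s]. *)
Lemma admissible_le_cut F A : admissible nu eta E b c F -> measurable A ->
  (finite_product nu eta F <= cut_value nu eta E b c A)%E.
Proof.
move=> [mF FE Fb Fc] mA.
have mFA := measurableI_snd mF mA.
have mFnA := measurableI_snd mF (measurableC mA).
rewrite cut_valueE.
have -> : F = (F `&` snd @^-1` (~` A)) `|` (F `&` snd @^-1` A).
  by rewrite -setIUr -preimage_setU setUC setUv preimage_setT setIT.
rewrite measureU //; last first.
  by apply/seteqP; split=> z // [[_ nAz] [_ /nAz]].
apply: leeD.
  rewrite [leLHS](product_ysection mFnA); apply: ae_ge0_le_integral => //.
  - exact: measurable_fun_ysection.
  - exact: measurable_bout.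
  apply: filterS Fb => t Ft _; rewrite boutE; case: ifPn => [|_]; last first.
    apply: le_trans Ft; apply: le_measure; rewrite ?inE.
    + exact: measurable_ysection.
    + exact: measurable_ysection.
    + by apply: le_ysection; exact: subIsetl.
  rewrite inE => At.
  rewrite (_ : ysection _ _ = set0) ?measure0 //.
  by apply/seteqP; split=> s //; rewrite /ysection /= inE => -[].
apply: ae_ge0_le_integral => //.
- exact: measurable_fun_xsection.
- exact: measurable_cin.
apply: filterS Fc => s Fs _ /=; rewrite /cin le_min; apply/andP; split.
  apply: le_trans Fs; apply: le_measure; rewrite ?inE.
  - exact: measurable_xsection.
  - exact: measurable_xsection.
  - by apply: le_xsection; exact: subIsetl.
rewrite degreeE; apply: le_measure; rewrite ?inE.
- exact: measurable_xsection.
- by apply: measurable_xsection; exact: measurableI_snd.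
- by apply: le_xsection => z [/FE Ez Az]; split.
Qed.

Lemma max_measure_minimum_cut : atomless nu -> atomless eta ->
  is_minimum
    [set cut_value nu eta E b c A | A in [set A : set T | measurable A]]
    (max_measure nu eta E b c).
Proof.
move=> anu aeta.
have max_le A : measurable A ->
    (max_measure nu eta E b c <= cut_value nu eta E b c A)%E.
  move=> mA; apply: ge_ereal_sup => _ [F adF <-].
  exact: admissible_le_cut.
split; last by move=> _ [A mA <-]; exact: max_le.
have [A [mA minA]] := exists_minimal_cut.
exists A => //; apply/eqP; rewrite eq_le max_le // andbT.
have /fineK <- := cut_value_fin_num mA.
apply/lee_addgt0Pr => e e0.
have [|F [adF leF]] := @near_optimal_admissible _ _ _ _ _ nu eta anu aeta
    b c mb mc hb hc E mE (fine (cut_value nu eta E b c A)) e e0.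
  by move=> B mB; rewrite fineK ?minA // cut_value_fin_num.
rewrite -leeBlDr //.
apply: (@le_trans _ _ (finite_product nu eta F)); last first.
  by apply: ereal_sup_ubound; exists F.
by have [mF _ _ _] := adF; rewrite -massE // -EFinB lee_fin.
Qed.

End cut.

Local Open Scope ereal_scope.

Theorem theorem7p10 (R : realType) (d1 d2 : measure_display)
    (S : measurableType d1) (T : measurableType d2)
    (nu : {finite_measure set S -> \bar R})
    (eta : {finite_measure set T -> \bar R})
    (hS : standard_measure_space nu) (hT : standard_measure_space eta)
    (b : T -> R) (c : S -> R)
    (mb : measurable_fun [set: T] b) (mc : measurable_fun [set: S] c)
    (hb : forall t, 0 <= (b t)%:E <= nu [set: S])
    (hc : forall s, 0 <= (c s)%:E <= eta [set: T])
    (E : set (S * T)) (mE : measurable E) :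
  is_minimum [set cut_value nu eta E b c A | A in [set A : set T | measurable A]]
             (max_measure nu eta E b c).
Proof.
have [_ anu] := hS; have [_ aeta] := hT.
apply: max_measure_minimum_cut => //.
- by move=> t; have := hb t; rewrite -massE // !lee_fin.
- by move=> s; have := hc s; rewrite -massE // !lee_fin.
Qed.
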